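(* For every integer $n\geq 2$, the following four identities hold: $$\sum_{\pi\in\mathfrak{S}_n}x^{\mathrm{des}(\pi)+1}=\sum_{\pi\in\mathcal{AS}_{n+1}}x^{\mathrm{des}(\pi)};$$ $$\sum_{\pi\in\mathfrak{S}_n}x^{\mathrm{pk}(\pi)+1}=\sum_{\pi\in\mathcal{AS}_{n+1}}x^{\mathrm{lpk}(\pi)};$$ $$\sum_{\pi\in\mathfrak{S}_n}x^{\mathrm{lpk}(\pi)}=\sum_{\pi\in\mathcal{AS}_{n+1}}x^{\mathrm{val}(\pi)};$$ $$\sum_{\pi\in\mathfrak{S}_n}x^{\mathrm{as}(\pi)+1}=\sum_{\pi\in\mathcal{AS}_{n+1}}x^{\mathrm{as}(\pi)}.$$
   Context: Let $\mathfrak{S}_m$ be the set of permutations of $[m]=\{1,\dots,m\}$, written as words $\pi=\pi(1)\cdots\pi(m)$. For $\pi\in\mathfrak{S}_m$: - $\mathrm{des}(\pi)$ is the number of descents, i.e. indices $i\in[m-1]$ with $\pi(i)>\pi(i+1)$. - $\mathrm{pk}(\pi)$ is the number of interior peaks, i.e. indices $i\in\{2,\dots,m-1\}$ with $\pi(i-1)<\pi(i)>\pi(i+1)$. - $\mathrm{lpk}(\pi)$ is the number of left peaks, i.e. indices $i\in[m-1]$ with $\pi(i-1)<\pi(i)>\pi(i+1)$, where $\pi(0)=0$. - $\mathrm{val}(\pi)$ is the number of valleys, i.e. indices $i\in\{2,\dots,m-1\}$ with $\pi(i-1)>\pi(i)<\pi(i+1)$. - $\mathrm{as}(\pi)$ is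 the length (number of terms) of the longest alternating subsequence of $\pi$, where an alternating subsequence is a subsequence $\pi(i_1),\pi(i_2),\ldots,\pi(i_k)$ with $i_1<i_2<\cdots<i_k$ and $\pi(i_1)>\pi(i_2)<\pi(i_3)>\cdots\pi(i_k)$ (so it starts with a descent; a single term is alternating). A succession in a word $w(1)\cdots w(r)$ of integers is an index $i\in[r-1]$ with $w(i+1)=w(i)+1$. For $\pi\in\mathfrak{S}_m$ and $k\in[m]$, the subword of $\pi$ restricted to $[k]$ is the word formed by the letters $1,\dots,k$ in the order in which they appear in $\pi$. The permutation $\pi$ avoids simsun successions if for all $k\in[m]$ the subword of $\pi$ restricted to $[k]$ contains no successions. $\mathcal{AS}_m$ denotes the set of permutations in $\mathfrak{S}_m$ that avoid simsun successions. For example, $\mathcal{AS}_2=\{21\}$ and $\mathcal{AS}_3=\{213,321\}$. *)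

(* Defs.v *)
From mathcomp Require Import all_boot all_fingroup all_algebra.
Set Implicit Arguments.
Unset Strict Implicit.
Unset Printing Implicit Defensive.

(* Elements of 'S_m permute {0, .., m-1}; both positions and letters are
   shifted by one to get the usual word on the letters 1, .., m. *)
Definition word (m : nat) (p : 'S_m) : seq nat := [seq (p i).+1 | i <- enum 'I_m].

(* The i-th letter w(i), counted from 1, with the convention w(0) = 0. *)
Definition letter (w : seq nat) (i : nat) : nat := nth 0 (0 :: w) i.

(* For a word of length m, [iota 1 m.-1] lists the indices 1, .., m-1 and
   [iota 2 (m - 2)] the indices 2, .., m-1. *)

Definition des (w : seq nat) : nat :=
  count (fun i => letter w i > letter w i.+1) (iota 1 (size w).-1).

Definition is_peak (w : seq nat) (i : nat) : bool :=
  (letter w i.-1 < letter w i) && (letter w i > letter w i.+1).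

Definition is_valley (w : seq nat) (i : nat) : bool :=
  (letter w i.-1 > letter w i) && (letter w i < letter w i.+1).

Definition pk (w : seq nat) : nat := count (is_peak w) (iota 2 (size w - 2)).

Definition lpk (w : seq nat) : nat := count (is_peak w) (iota 1 (size w).-1).

Definition nval (w : seq nat) : nat := count (is_valley w) (iota 2 (size w - 2)).

(* w(1) > w(2) < w(3) > ... *)
Definition alternating (w : seq nat) : bool :=
  all (fun i => if odd i then letter w i > letter w i.+1
                else letter w i < letter w i.+1) (iota 1 (size w).-1).

(* Every subsequence of w is [mask b w] for some bit vector b. *)
Definition las (w : seq nat) : nat :=
  \max_(b : (size w).-tuple bool | alternating (mask b w)) size (mask b w).

Definition has_succession (w : seq nat) : bool :=
  has (fun i => letter w i.+1 == (letter w i).+1) (iota 1 (size w).-1).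

Definition restrict (k : nat) (w : seq nat) : seq nat := [seq a <- w | 1 <= a <= k].

Definition avoids_simsun_successions (m : nat) (p : 'S_m) : bool :=
  all (fun k => ~~ has_succession (restrict k (word p))) (iota 1 m).

Definition AS (m : nat) : {set 'S_m} := [set p | avoids_simsun_successions p].

(* Main.v *)
Require Import Defs.
From mathcomp Require Import all_boot all_fingroup all_algebra.
From mathcomp Require Import ring zify.
Set Implicit Arguments.
Unset Strict Implicit.
Unset Printing Implicit Defensive.
Import GRing.Theory.

(** Both sides of each identity are grown by inserting a new largest letter,
    and the two growth processes turn out to be the same up to a shift by one
    of the statistic.

    Words on 1, ..., m+1 arise by putting m+1 into any of the m+1 gaps of a
    word on 1, ..., m ([perm_words]).  Words without simsun successions arise
    in the same way, except that m+1 must not be put immediately after m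
    ([avoids_ins]).  The number of descents and the length of the longest
    alternating subsequence are not changed by inserting m+1 immediately
    after m, since a maximum replaced by a consecutive pair keeps the shape of
    the word.  So in passing from all words to words without simsun
    successions, exactly one gap that preserves the statistic is lost.

    For a word of length m with d descents, d+1 gaps preserve d and m-d gaps
    raise it by one; for a word whose longest alternating subsequence has
    length t, t gaps preserve t, one raises it by 1 and m-t raise it by 2
    ([sum_ins_descents], [sum_ins_turns]).  With one preserving gap removed
    and m replaced by m+1, the counts for the value k+1 become the unrestricted
    counts for the value k and length m.  By induction the statistic plus one
    on the words on 1, ..., n is distributed as the statistic itself on the
    words on 1, ..., n+1 without simsun successions ([equidistribution]).
    All sums carry an arbitrary weight G, which absorbs both the shifts of
    exponents in the induction and the change of statistic made below.

    The identities on peaks and valleys follow from the one on alternating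
    subsequences.  The length t of the longest alternating subsequence is the
    number of monotone runs of the word preceded by 0 ([las_turns]); each left
    peak ends an ascending run that another run follows, so there are
    floor(t/2) left peaks and floor((t-1)/2) valleys ([lpk_turns],
    [nval_turns]).  Interior peaks become valleys under complementation of the
    letters ([nval_compl]), and complementation permutes the words. *)

(** * Inserting a new maximum *)

Definition ins (M i : nat) (w : seq nat) : seq nat := take i w ++ M :: drop i w.

Fixpoint descents (x : nat) (s : seq nat) : nat :=
  if s is y :: s' then (y < x) + descents y s' else 0.

(** The number of changes of direction in the word x followed by s, when x has
    been reached by an ascent (up = true) or by a descent (up = false).  With
    x = 0 and up = false the initial ascent counts, so that
    [turns false 0 w] is the number of monotone runs of w preceded by 0.
    A repeated letter counts as a descent, so that the two directions are
    complementary. *)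
Fixpoint turns (up : bool) (x : nat) (s : seq nat) : nat :=
  if s is y :: s' then (up (+) (x < y)) + turns (x < y) y s' else 0.

Section Insertion.
Local Open Scope ring_scope.
Variables (R : comNzRingType) (M : nat).

Lemma sum_ins_cons (F : seq nat -> R) y s :
  \sum_(i < (size (y :: s)).+1) F (ins M i (y :: s)) =
  F (M :: y :: s) + \sum_(i < (size s).+1) F (y :: ins M i s).
Proof. by rewrite big_ord_recl /= /ins take0 drop0. Qed.

(** The new letter, placed in a descent or at the end, preserves the number of
    descents, and in an ascent raises it by one.  Here x, smaller than the new
    letter, stands before the first gap, so that gap behaves like the others. *)
Lemma sum_ins_descents (G : nat -> R) x s :
  (x < M)%N -> all (ltn^~ M) s ->
  \sum_(i < (size s).+1) G (descents x (ins M i s)) =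
  (descents x s).+1%:R * G (descents x s)
  + ((size s)%:R - (descents x s)%:R) * G (descents x s).+1.
Proof.
elim: s G x => [|y s IHs] G x ltxM /=.
  by move=> _; rewrite big_ord_recl big_ord0 /= ltnNge (ltnW ltxM) /=; ring.
case/andP=> ltyM ltsM; rewrite (sum_ins_cons (fun t => G (descents x t))) /=.
rewrite ltyM (ltnNge M x) (ltnW ltxM) /= add0n add1n.
(* The step from x to y only shifts the values that G is evaluated at. *)
rewrite (IHs (fun k => G ((y < x) + k)%N)) //.
by case: (y < x)%N; rewrite /= ?add0n ?add1n -!natr1; ring.
Qed.

(** A gap next to a peak preserves the number of turns, and so does the last
    gap after a final ascent.  The gap just before the last letter after a
    final ascent, or the last gap after a final descent, adds one turn; every
    other gap adds two.  For up = false this makes t, 1 and |s| - t gaps, where t is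
    the number of turns.  For up = true the ascent leading to x belongs to the
    word as well, which would make t + 1, 1 and |s| - t gaps together with the
    gap on the left of x.  That gap is not among the summands: it preserves
    the number of turns when x is a peak and adds two otherwise, and c
    tells the cases apart.  If moreover s is empty, the only gap prolongs the
    ascent that leads to x. *)
Lemma sum_ins_turns (G : nat -> R) up x s :
  (x < M)%N -> all (ltn^~ M) s ->
  \sum_(i < (size s).+1) G (turns up x (ins M i s)) =
  if up && nilp s then G 0%N else
  let t := turns up x s in let c := (up && (x < head x s)%N)%:R in
  (t%:R + c) * G t + G t.+1 + ((size s)%:R - t%:R - c) * G t.+2.
Proof.
elim: s G up x => [|y s IHs] G up x ltxM /=.
  move=> _; rewrite big_ord_recl big_ord0 /= ltxM andbT.
  by case: up; rewrite /= ?addn0; ring.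
case/andP=> ltyM ltsM; rewrite (sum_ins_cons (fun t => G (turns up x t))) /=.
rewrite ltxM (ltnNge M y) (ltnW ltyM) /= andbF.
rewrite (IHs (fun k => G ((up (+) (x < y)) + k)%N)) // => {IHs}.
case: s ltsM => [|z s] _ /=; case: (x < y)%N; case: up => /=;
  rewrite ?add0n ?add1n ?addn0 /=; try ring.
(* When the word goes on, the direction of the next step decides whether y is
   a peak. *)
all: by case: (y < z)%N; rewrite /= ?add0n ?add1n -?natr1; ring.
Qed.

End Insertion.

Lemma descents_cat_succ m x u v :
  x < m -> all (ltn^~ m) u -> all (ltn^~ m) v ->
  descents x (u ++ m :: m.+1 :: v) = descents x (u ++ m :: v).
Proof.
move=> ltxm ltu ltv; elim: u x ltxm ltu => [|y u IHu] x ltxm /=.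
  rewrite (ltnNge m.+1) leqnSn => _.
  case: v ltv => [|z v] //= /andP[ltzm _].
  by rewrite ltzm (ltn_trans ltzm).
by case/andP=> ltym ltum; rewrite IHu.
Qed.

Lemma turns_cat_succ m up x u v :
  x < m -> all (ltn^~ m) u -> all (ltn^~ m) v ->
  turns up x (u ++ m :: m.+1 :: v) = turns up x (u ++ m :: v).
Proof.
move=> ltxm ltu ltv; elim: u up x ltxm ltu => [|y u IHu] up x ltxm /=.
  rewrite ltxm ltnSn /= => _.
  case: v ltv => [|z v] //= /andP[ltzm _].
  by rewrite !(ltnNge _ z) ltnW ?(ltn_trans ltzm) // (ltnW ltzm).
by case/andP=> ltym ltum; rewrite IHu.
Qed.

(** * The words of permutations, generated by insertion *)

Lemma size_ins M i w : size (ins M i w) = (size w).+1.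
Proof. by rewrite size_cat /= addnS -size_cat cat_take_drop. Qed.

Lemma perm_ins M i w : perm_eq (ins M i w) (M :: w).
Proof. by rewrite /ins perm_catC /= perm_cons perm_catC cat_take_drop. Qed.

Fixpoint words (m : nat) : seq (seq nat) :=
  if m is m'.+1 then [seq ins m i w | w <- words m', i <- iota 0 m]
  else [:: [::]].

Lemma iota1S m : iota 1 m.+1 = rcons (iota 1 m) m.+1.
Proof. by rewrite -cats1 -(addn1 m) iotaD addnC. Qed.

Lemma perm_iotaS m : perm_eq (m.+1 :: iota 1 m) (iota 1 m.+1).
Proof. by rewrite iota1S perm_sym perm_rcons. Qed.

Lemma perm_words m w : (w \in words m) = perm_eq w (iota 1 m).
Proof.
elim: m w => [|m IHm] w.
  by rewrite inE; apply/eqP/perm_nilP.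
apply/allpairsP/idP => [[[v i] /= [vIn _ ->]]|wP].
  rewrite (permPl (perm_ins _ _ _)) -(permPr (perm_iotaS m)) perm_cons.
  by rewrite -IHm.
have mw : m.+1 \in w by rewrite (perm_mem wP) mem_iota /= add1n ltnS leqnn.
case/splitPr: mw wP => u v wP.
have uvP : perm_eq (u ++ v) (iota 1 m).
  rewrite -(perm_cons m.+1) (permPr (perm_iotaS m)) -(permPr wP) perm_sym.
  by rewrite -[m.+1 :: v]cat1s perm_catCA.
exists (u ++ v, size u); split.
- by rewrite IHm.
- have := perm_size uvP; rewrite mem_iota add0n ltnS size_cat size_iota => <-.
  exact: leq_addr.
- by rewrite /ins take_size_cat // drop_size_cat.
Qed.

Lemma size_words m : size (words m) = m`!.
Proof.
elim: m => // m IHm; rewrite [words _]/(allpairs_dep _ _ _).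
by rewrite (size_allpairs (fun w i => ins m.+1 i w)) size_iota IHm factS mulnC.
Qed.

Lemma size_word m (p : 'S_m) : size (word p) = m.
Proof. by rewrite size_map size_enum_ord. Qed.

Lemma nth_word m (p : 'S_m) (i : 'I_m) : nth 0 (word p) i = (p i).+1.
Proof. by rewrite (nth_map i) ?size_enum_ord // nth_ord_enum. Qed.

Lemma word_inj m : injective (@word m).
Proof.
move=> p q eqpq; apply/permP => i; apply/val_inj/succn_inj.
by rewrite -!nth_word eqpq.
Qed.

Lemma perm_word m (p : 'S_m) : perm_eq (word p) (iota 1 m).
Proof.
apply: uniq_perm; rewrite ?iota_uniq //.
  by rewrite map_inj_uniq ?enum_uniq // => i j /succn_inj/val_inj/perm_inj.
move=> k; rewrite mem_iota add1n ltnS; apply/mapP/andP=> [[i _ ->] //|[k0 kS]].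
have ltk : k.-1 < m by lia.
by exists ((p^-1)%g (Ordinal ltk)); rewrite ?mem_enum // permKV /= prednK.
Qed.

Lemma sum_words (V : nmodType) m (P : pred (seq nat)) (F : seq nat -> V) :
  (\sum_(p : 'S_m | P (word p)) F (word p) = \sum_(w <- words m | P w) F w)%R.
Proof.
have eqw : perm_eq [seq word p | p <- enum 'S_m] (words m).
  (* Both lists have m! entries, so one inclusion and the distinctness of the
     entries of one of them suffice. *)
  have uw : uniq [seq word p | p <- enum 'S_m].
    by rewrite map_inj_uniq ?enum_uniq //; apply: word_inj.
  have sw : {subset [seq word p | p <- enum 'S_m] <= words m}.
    by move=> w /mapP[p _ ->]; rewrite perm_words perm_word.
  have sz : size (words m) <= size [seq word p | p <- enum 'S_m].
    by rewrite size_map -cardE card_Sn size_words.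
  have [_ eqi] := uniq_min_size uw sw sz.
  exact: uniq_perm (leq_size_uniq uw sw sz) eqi.
by rewrite -(perm_big _ eqw) big_map /= big_enum_cond.
Qed.

Lemma perm_iotaP m (w : seq nat) : perm_eq w (iota 1 m) ->
  [/\ size w = m, uniq w & forall k, (k \in w) = (1 <= k <= m)].
Proof.
move=> wP; have memw k : (k \in w) = (1 <= k <= m).
  by rewrite (perm_mem wP) mem_iota add1n ltnS.
by rewrite (perm_size wP) size_iota (perm_uniq wP) iota_uniq.
Qed.

(** * Avoiding simsun successions *)

Definition avoids (w : seq nat) : bool :=
  all (fun k => ~~ has_succession (restrict k w)) (iota 1 (size w)).

Lemma avoids_word m (p : 'S_m) : (p \in AS m) = avoids (word p).
Proof. by rewrite inE /avoids size_word. Qed.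

Definition non_succ (a b : nat) : bool := b != a.+1.

Lemma has_successionN w : ~~ has_succession w = sorted non_succ w.
Proof.
case: w => [|x w] //; rewrite /has_succession -all_predC /letter.
apply/allP/(sortedP 0) => /= ok i.
  by rewrite ltnS => lti; apply: (ok i.+1); rewrite mem_iota.
by case: i => [|i]; rewrite mem_iota // => lti; apply: ok.
Qed.

Lemma restrict_id m w : (forall k, (k \in w) = (1 <= k <= m)) -> restrict m w = w.
Proof. by move=> memw; apply/all_filterP/allP=> k; rewrite memw. Qed.

(** The new maximum m+1 can only create a succession behind the letter m, and
    it cannot be the first letter of one. *)
Lemma sorted_ins m (w : seq nat) i : 0 < m -> perm_eq w (iota 1 m) -> i <= m ->
  sorted non_succ w -> sorted non_succ (ins m.+1 i w) = (i != (index m w).+1).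
Proof.
move=> m0 /perm_iotaP[szw uw memw] lei.
(* The letter m+1 in front makes no succession with the letters at hand; it
   gives the empty prefix a last letter. *)
have pathE v : {subset v <= m.+1 :: w} -> sorted non_succ v = path non_succ m.+1 v.
  case: v => //= y v sv; suff -> : non_succ m.+1 y by [].
  have : y \in m.+1 :: w by rewrite sv ?mem_head.
  by rewrite inE memw /non_succ; lia.
rewrite (pathE w) => [|k kw]; last by rewrite inE kw orbT.
rewrite pathE => [|k]; last by rewrite (perm_mem (perm_ins _ _ _)).
rewrite -{1}[w](cat_take_drop i) /ins !cat_path /= => /andP[-> pd] /=.
have -> : path non_succ m.+1 (drop i w).
  case dE: (drop i w) pd => [|y v] //= /andP[_ ->]; rewrite andbT.
  have : y \in w by rewrite -[w](cat_take_drop i) dE mem_cat mem_head orbT.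
  by rewrite memw /non_succ; lia.
rewrite andbT /non_succ eqSS eq_sym; congr (~~ _).
case: i lei {pd} => [|j] lei; first by rewrite take0 /=; lia.
have ltj : j < size w by rewrite szw.
rewrite (take_nth 0 ltj) last_rcons eqSS.
apply/eqP/eqP=> [<-|->]; first by rewrite index_uniq.
by rewrite nth_index // memw m0 /=.
Qed.

(** Deleting m+1 leaves all the restrictions to smaller alphabets unchanged, so
    only the new word itself has to be tested. *)
Lemma avoids_ins m (w : seq nat) i : 0 < m -> perm_eq w (iota 1 m) -> i <= m ->
  avoids (ins m.+1 i w) = avoids w && (i != (index m w).+1).
Proof.
move=> m0 wP lei; have [szw _ memw] := perm_iotaP wP.
rewrite /avoids size_ins szw iota1S all_rcons andbC.
rewrite restrict_id; last first.
  by move=> k; rewrite (perm_mem (perm_ins _ _ _)) inE memw; lia.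
rewrite (@eq_in_all _ _ (fun k => ~~ has_succession (restrict k w))); last first.
  move=> k; rewrite mem_iota add1n ltnS => /andP[_ lek].
  rewrite /restrict /ins filter_cat /= ltnNge lek /=.
  by rewrite -filter_cat cat_take_drop.
case avw: (all _ _) => //=.
rewrite has_successionN sorted_ins // -has_successionN.
have /allP/(_ m) := avw; rewrite restrict_id //; apply.
by rewrite mem_iota m0 add1n ltnS leqnn.
Qed.

(** * Equal growth of the two families *)

Section Equidistribution.
Local Open Scope ring_scope.
Variable R : comNzRingType.

(** [growth m G k] is the total weight of the words obtained by inserting m+1
    into a word of length m on which f takes the value k.  The equation for
    [growth m.+1 G k.+1] says that, once the value is shifted by one, a word of
    length m+1 offers the gaps of a word of length m and one more, which
    preserves f; the latter is cancelled by the forbidden gap after the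
    maximum.  The induction starts from the words 1 and 21. *)
Lemma equidistribution (f : seq nat -> nat)
    (growth : nat -> (nat -> R) -> nat -> R) :
  (forall m (G : nat -> R) w, perm_eq w (iota 1 m) ->
     \sum_(i < m.+1) G (f (ins m.+1 i w)) = growth m G (f w)) ->
  (forall m w, (0 < m)%N -> perm_eq w (iota 1 m) ->
     f (ins m.+1 (index m w).+1 w) = f w) ->
  (forall m G k, growth m.+1 G k.+1 = growth m (G \o succn) k + G k.+1) ->
  f [:: 2; 1] = (f [:: 1]).+1 ->
  forall n (G : nat -> R), (0 < n)%N ->
    \sum_(w <- words n) G (f w).+1 = \sum_(w <- words n.+1 | avoids w) G (f w).
Proof.
move=> growthP fix_max growthS base; elim=> [|[|n] IHn] G // _.
  by rewrite big_seq1 /= !big_cons big_nil /= -base addr0.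
have big_ins (P : pred (seq nat)) (F : seq nat -> R) m :
  \sum_(w <- words m.+1 | P w) F w =
  \sum_(w <- words m) \sum_(i < m.+1 | P (ins m.+1 i w)) F (ins m.+1 i w).
  rewrite big_mkcond [words _]/(allpairs_dep _ _ _) big_allpairs_dep.
  apply: eq_bigr => w _.
  by rewrite -[iota 0 _]/(index_iota 0 m.+1) big_mkord -big_mkcond.
rewrite [RHS]big_ins big_ins.
(* The subtracted term is the forbidden gap. *)
transitivity (\sum_(w <- words n.+2 | avoids w) (growth n.+2 G (f w) - G (f w))).
  rewrite -(IHn (fun k => growth n.+2 G k - G k)) //.
  rewrite big_seq [RHS]big_seq; apply: eq_bigr => w; rewrite perm_words => wP.
  by rewrite growthS addrK -(growthP _ (G \o succn)).
rewrite big_mkcond big_seq [RHS]big_seq; apply: eq_bigr => w; rewrite perm_words => wP.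
have [szw _ memw] := perm_iotaP wP.
rewrite (eq_bigl (fun i : 'I_n.+3 => avoids w && (i != (index n.+2 w).+1 :> nat)));
  last by move=> i; rewrite avoids_ins // -ltnS.
case: (avoids w) => /=; last by rewrite big_pred0.
have lt_ix : ((index n.+2 w).+1 < n.+3)%N.
  by rewrite ltnS -[X in (_ < X)%N]szw index_mem memw leqnn.
rewrite -growthP // (bigD1 (Ordinal lt_ix)) //= fix_max //.
by rewrite addrAC subrr add0r.
Qed.

End Equidistribution.

Lemma ins_after_max m (w : seq nat) : 0 < m -> perm_eq w (iota 1 m) ->
  exists u v, [/\ all (ltn^~ m) u, all (ltn^~ m) v, w = u ++ m :: v
    & ins m.+1 (index m w).+1 w = u ++ m :: m.+1 :: v].
Proof.
move=> m0 wP; have [_ uw memw] := perm_iotaP wP.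
have mw : m \in w by rewrite memw m0 /=.
case/splitPr: {wP} mw uw memw => u v.
rewrite cat_uniq /= => /and4P[_ /norP[mu _] mv _] memw; exists u, v.
have ltm k : k \in u ++ v -> k < m.
  rewrite mem_cat => kuv; rewrite ltn_neqAle; have /andP[-> _] : (k <= m) && (0 < k).
    by rewrite andbC -memw mem_cat inE; case/orP: kuv => ->; rewrite ?orbT.
  by rewrite andbT; apply/eqP=> km; move: kuv; rewrite km (negPf mu) (negPf mv).
split=> //.
- by apply/allP=> k ku; apply: ltm; rewrite mem_cat ku.
- by apply/allP=> k kv; apply: ltm; rewrite mem_cat kv orbT.
rewrite index_cat (negPf mu) /= eqxx addn0 /ins -(cat_rcons m u v).
by rewrite take_size_cat ?size_rcons // drop_size_cat ?size_rcons // cat_rcons.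
Qed.

Lemma descents_equidistributed (R : comNzRingType) n (G : nat -> R) : 0 < n ->
  (\sum_(w <- words n) G (descents 0 w).+1 =
  \sum_(w <- words n.+1 | avoids w) G (descents 0 w))%R.
Proof.
apply: (@equidistribution _ _
  (fun m G k => k.+1%:R * G k + (m%:R - k%:R) * G k.+1)%R) => //.
- move=> m {}G w wP; have [szw _ memw] := perm_iotaP wP.
  have := @sum_ins_descents _ m.+1 G 0 w; rewrite szw; apply=> //.
  by apply/allP=> k; rewrite memw /= ltnS => /andP[].
- move=> m w m0 wP; have [u [v [ltu ltv -> ->]]] := ins_after_max m0 wP.
  exact: descents_cat_succ.
- by move=> m {}G k /=; ring.
Qed.

Lemma turns_equidistributed (R : comNzRingType) n (G : nat -> R) : 0 < n ->
  (\sum_(w <- words n) G (turns false 0 w).+1 =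
  \sum_(w <- words n.+1 | avoids w) G (turns false 0 w))%R.
Proof.
apply: (@equidistribution _ _
  (fun m G k => k%:R * G k + G k.+1 + (m%:R - k%:R) * G k.+2)%R) => //.
- move=> m {}G w wP; have [szw _ memw] := perm_iotaP wP.
  have := @sum_ins_turns _ m.+1 G false 0 w; rewrite szw /= addr0 subr0; apply=> //.
  by apply/allP=> k; rewrite memw /= ltnS => /andP[].
- move=> m w m0 wP; have [u [v [ltu ltv -> ->]]] := ins_after_max m0 wP.
  exact: turns_cat_succ.
- by move=> m {}G k /=; ring.
Qed.

(** * Peaks and valleys as functions of the number of turns *)

Lemma count_iotaS (P : pred nat) k n :
  count P (iota k.+1 n) = count (fun i => P i.+1) (iota k n).
Proof. by rewrite -add1n iotaDl count_map. Qed.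

Lemma des_descents w : des w = descents 0 w.
Proof.
case: w => [|x s] //; rewrite /des /= add0n /letter count_iotaS /=.
elim: s x => [|y s IHs] x //=; congr (_ + _).
by rewrite count_iotaS -IHs.
Qed.

Definition kink (top : bool) (a b c : nat) : bool :=
  if top then (a < b) && (b > c) else (a > b) && (b < c).

(** Peaks and valleys alternate among the turns, so each kind accounts for half
    of them; the parity depends on whether the initial direction makes the
    first turn one of the requested kind. *)
Lemma count_kinks top a x s : uniq [:: a, x & s] ->
  let up := a < x in
  count (fun i => kink top (nth 0 [:: a, x & s] i) (nth 0 (x :: s) i) (nth 0 s i))
    (iota 0 (size s)) = ((top == up) + turns up x s)./2.
Proof.
elim: s a x => [|y s IHs] a x /=; first by case: (_ == _).
rewrite !inE => /and4P[/norP[ax _] /norP[xy xs] ys us].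
rewrite count_iotaS IHs /=; last by rewrite inE negb_or xy xs ys us.
rewrite /kink {IHs}.
by case: top; case: (ltngtP a x) ax => //= _ _; case: (ltngtP x y) xy => //= _ _;
  rewrite ?add0n ?add1n ?addn0.
Qed.

Lemma lpk_turns w : uniq (0 :: w) -> lpk w = (turns false 0 w)./2.
Proof.
case: w => [|x s] // uw; rewrite /lpk count_iotaS.
have x0 : 0 < x by move: uw; rewrite /= inE lt0n eq_sym; case: eqP.
by have := count_kinks true uw; rewrite /= x0.
Qed.

Lemma nval_turns w : uniq (0 :: w) -> nval w = (turns false 0 w).-1./2.
Proof.
case: w => [|x [|y s]] // uw; rewrite /nval.
  by rewrite /=; case: (_ < _).
have x0 : 0 < x by move: uw; rewrite /= inE lt0n eq_sym; case: eqP.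
rewrite /= x0 /= subn2 /= !count_iotaS.
have /andP[_ uxy] := uw.
have := count_kinks false uxy; rewrite /= => ->.
by case: (x < y).
Qed.

Lemma nval_compl n (w : seq nat) : perm_eq w (iota 1 n) ->
  nval [seq n.+1 - k | k <- w] = pk w.
Proof.
move=> wP; have [_ _ memw] := perm_iotaP wP.
have lt_letter i : 0 < i <= size w -> letter w i < n.+1.
  case: i => //= i lti; have : nth 0 w i \in w by rewrite mem_nth.
  by rewrite memw ltnS => /andP[].
rewrite /nval /pk size_map; apply: eq_in_count => i; rewrite mem_iota => lti.
have letterC j : 0 < j <= size w ->
    letter [seq n.+1 - k | k <- w] j = n.+1 - letter w j.
  by case: j => // j ltj; rewrite /letter /= (nth_map 0).
have [i1 i2 i3] : [/\ 0 < i.-1 <= size w, 0 < i <= size w & 0 < i.+1 <= size w].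
  by move: lti; split; lia.
rewrite /is_valley /is_peak !letterC //.
by move: (lt_letter _ i1) (lt_letter _ i2) (lt_letter _ i3); lia.
Qed.

Lemma sum_compl (V : nmodType) n (F : seq nat -> V) :
  (\sum_(p : 'S_n) F (word p) = \sum_(p : 'S_n) F [seq (n.+1 - k)%N | k <- word p])%R.
Proof.
rewrite (reindex_inj (mulIg (perm (@rev_ord_inj n)))) /=; apply: eq_bigr => p _.
congr (F _); rewrite /word -map_comp; apply: eq_map => i /=.
by rewrite permM permE /= subSS subnSK.
Qed.

(** * The longest alternating subsequence *)

(** With up = true the next step has to go down, as in [turns]: x is thought of
    as reached by an ascent. *)
Fixpoint alternates (up : bool) (x : nat) (s : seq nat) : bool :=
  if s is y :: s' then (if up then y < x else x < y) && alternates (~~ up) y s'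
  else true.

Lemma alternates_cons up x y s : alternates up x (y :: s) =
  (if up then y < x else x < y) && alternates (~~ up) y s.
Proof. by []. Qed.

Lemma alternatingE x s : alternating (x :: s) = alternates true x s.
Proof.
rewrite /alternating /letter /= -[1]/(1 + 0) iotaDl all_map /=.
rewrite (eq_all (a2 := fun i => let w := x :: s in
  if odd i (+) true then nth 0 w i > nth 0 w i.+1 else nth 0 w i < nth 0 w i.+1));
  last by move=> i /=; rewrite addbT.
elim: s x true => [|y s IHs] x up //=; congr (_ && _).
rewrite -IHs -[1]/(1 + 0) iotaDl all_map; apply: eq_all => i /=.
by rewrite addNb addbN.
Qed.

Lemma turns_negb up x s : turns up x s <= (turns (~~ up) x s).+1.
Proof. by case: s => //= y s; case: up; case: (x < y) => /=; lia. Qed.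

(** Each further term of an alternating sequence forces one more change of
    direction of the word.  The last chosen term z need not be the current
    letter x; it suffices that x is at least as extreme, so that every step
    available from z in the required direction is also available from x. *)
Lemma alternates_le_turns up x z u s : subseq u s -> alternates up z u ->
  (if up then z <= x else x <= z) -> size u <= turns up x s.
Proof.
elim: s up x z u => [|y s IHs] up x z u; first by rewrite subseq0 => /eqP->.
case: u => [|a u] // sub; rewrite alternates_cons => /andP[az alt] zx.
have subu : subseq u s.
  by move: sub => /=; case: eqP => // _; apply/subseq_trans/subseq_cons.
have [turn|noturn] := boolP (up (+) (x < y)).
  have yE : (x < y) = ~~ up by move: turn; case: up {az alt zx}; case: (x < y).
  rewrite [turns _ _ _]/= yE addbN addbb add1n.
  (* Either y is at least as extreme as a in the new direction, and bounds what
     follows a, or a can be reached from y in the old direction. *)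
  have [ya|ay] := boolP (if up then y <= a else a <= y).
    by apply: (IHs _ y a) => //; move: ya; case: up {az alt zx turn yE}.
  have {}sub : subseq (a :: u) s.
    move: sub ay => /=; case: eqP => // ->.
    by rewrite leqnn; case: up {az alt zx turn yE}.
  apply: leq_trans (turns_negb _ _ _); apply: (IHs up y y) => //.
    rewrite alternates_cons alt andbT; move: ay.
    by case: up {az alt zx turn yE}; rewrite -ltnNge.
  by case: up {az alt zx turn yE ay}.
have yE : (x < y) = up by move: noturn; case: up {az alt zx}; case: (x < y).
rewrite [turns _ _ _]/= yE addbb add0n.
have {}sub : subseq (a :: u) s.
  move: sub => /=; case: eqP => // ay; move: az zx yE; rewrite ay.
  by case: up {alt noturn}; lia.
apply: (IHs up y z) => //; first by rewrite alternates_cons az.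
by move: az zx yE; case: up {alt noturn}; lia.
Qed.

(** Choosing the end of each monotone run gives an alternating subsequence in
    which one term per turn follows z.  The first term z is the end of the
    current run, hence possibly beyond x. *)
Lemma alternates_of_turns up x s : uniq (x :: s) ->
  exists z u, [/\ subseq (z :: u) (x :: s), alternates up z u,
    if up then x <= z else z <= x & size u = turns up x s].
Proof.
elim: s up x => [|y s IHs] up x.
  by exists x, [::]; rewrite /= eqxx; split=> //; case: up.
rewrite [uniq _]/= inE => /andP[/norP[xy xs] uys].
have [turn|noturn] := boolP (up (+) (x < y)).
  have yE : (x < y) = ~~ up by move: turn; case: up; case: (x < y).
  have [z [u [sub alt zy szu]]] := IHs (~~ up) y uys.
  (* The run ends at x. *)
  exists x, (z :: u); split.
  - by rewrite /= eqxx.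
  - rewrite alternates_cons alt andbT; move: xy zy yE.
    by rewrite neq_ltn; case: up {turn alt szu} => /=; lia.
  - by case: up {turn alt szu zy yE}.
  - by rewrite /= szu yE addbN addbb.
have yE : (x < y) = up by move: noturn; case: up; case: (x < y).
have [z [u [sub alt zy szu]]] := IHs up y uys.
exists z, u; split=> //.
- exact: subseq_trans sub (subseq_cons _ _).
- by move: zy yE; case: up {noturn alt szu}; lia.
- by rewrite szu /= yE addbb.
Qed.

Lemma las_turns w : uniq (0 :: w) -> las w = turns false 0 w.
Proof.
move=> uw; have pos u : subseq u w -> alternating u = alternates false 0 u.
  case: u => [|y u] // /mem_subseq/(_ y (mem_head _ _)) yw.
  rewrite alternatingE /=; suff -> : 0 < y by [].
  by rewrite lt0n; apply: contraTneq yw => ->; case/andP: uw.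
apply/eqP; rewrite eqn_leq; apply/andP; split.
  apply/bigmax_leqP => b; rewrite pos ?mask_subseq // => alt.
  exact: alternates_le_turns (mask_subseq _ _) alt _.
(* The leading 0 is its own run end, so what follows it is a subsequence of w
   that starts with a step up from 0. *)
have [z [u [sub alt z0 szu]]] := alternates_of_turns false uw.
have {z0} z0 : z = 0 by apply/eqP; rewrite -leqn0.
move: sub alt; rewrite {z}z0 /= => sub alt; rewrite -szu.
have [b szb ub] := subseqP sub.
rewrite ub; apply: (@leq_bigmax_cond _ _
  (fun b : (size w).-tuple bool => size (mask b w)) (Tuple (introT eqP szb))).
by rewrite /= -ub pos.
Qed.

(** * The four identities *)

Local Open Scope ring_scope.

Theorem theorem5 (n : nat) (hn : (2 <= n)%N) :
  [/\ \sum_(p : 'S_n) 'X^(des (word p) + 1) =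
        \sum_(p in AS n.+1) 'X^(des (word p)) :> {poly int},
      \sum_(p : 'S_n) 'X^(pk (word p) + 1) =
        \sum_(p in AS n.+1) 'X^(lpk (word p)) :> {poly int},
      \sum_(p : 'S_n) 'X^(lpk (word p)) =
        \sum_(p in AS n.+1) 'X^(nval (word p)) :> {poly int}
    & \sum_(p : 'S_n) 'X^(las (word p) + 1) =
        \sum_(p in AS n.+1) 'X^(las (word p)) :> {poly int}].
Proof.
have n0 : (0 < n)%N by apply: ltnW.
have uniq0 m (p : 'S_m) : uniq (0%N :: word p).
  have [_ uw memw] := perm_iotaP (perm_word p).
  by rewrite cons_uniq memw uw.
have transfer (f : seq nat -> nat) :
    (forall G : nat -> {poly int}, \sum_(w <- words n) G (f w).+1 =
      \sum_(w <- words n.+1 | avoids w) G (f w)) ->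
    forall G : nat -> {poly int}, \sum_(p : 'S_n) G (f (word p)).+1 =
      \sum_(p in AS n.+1) G (f (word p)).
  move=> eqf G; rewrite (eq_bigl _ _ (@avoids_word n.+1)).
  rewrite (sum_words _ _ (fun w => G (f w))) -eqf.
  exact: (sum_words _ xpredT (fun w => G (f w).+1)).
have eq_des := transfer _ (fun G => descents_equidistributed G n0).
have eq_las := transfer _ (fun G => turns_equidistributed G n0).
split.
- under eq_bigr do rewrite des_descents addn1.
  under [RHS]eq_bigr do rewrite des_descents.
  exact: (eq_des (fun k => 'X^k)).
- under [RHS]eq_bigr do rewrite lpk_turns //.
  rewrite -(eq_las (fun k => 'X^(k./2))).
  transitivity (\sum_(p : 'S_n) 'X^(nval (word p) + 1) : {poly int}).
    rewrite [RHS](sum_compl n (fun w => 'X^(nval w + 1))).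
    by apply: eq_bigr => p _; rewrite (nval_compl (perm_word p)).
  apply: eq_bigr => p _; rewrite nval_turns // addn1; congr 'X^_.
  have : (0 < size (word p))%N by rewrite size_word.
  have := uniq0 n p; case: (word p) => [|x s] //= /andP[].
  rewrite inE eq_sym => /norP[x0 _] _.
  by rewrite (_ : (0 < x)%N) // lt0n.
- under eq_bigr do rewrite lpk_turns //.
  under [RHS]eq_bigr do rewrite nval_turns //.
  exact: (eq_las (fun k => 'X^(k.-1./2))).
- under eq_bigr do rewrite las_turns // addn1.
  under [RHS]eq_bigr do rewrite las_turns //.
  exact: (eq_las (fun k => 'X^k)).
Qed.
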